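(* Let $C$ be a constant such that $|f(x)-B_N(f,x)|\le C\,\omega_{[0,1]}\big(f,\sqrt{x(1-x)/N}\big)$ for all $f\in C[0,1]$, all $N\ge1$ and all $x\in[0,1]$, where $B_N(f,x)=\sum_{i=0}^N\binom Ni x^i(1-x)^{N-i}f(i/N)$. Let $\mathcal L\ge0$ and let $F:[0,1]\to K(\mathbb R^n)$ satisfy $\mathrm{haus}(F(x),F(y))\le\mathcal L|x-y|$ for all $x,y\in[0,1]$. Then for all $N\ge1$ and $x\in[0,1]$, $$\mathrm{haus}\big(B^M_N(F,x),F(x)\big)\le \frac{2\mathcal L}{N}+C\,\mathcal L\,\sqrt{\frac{x(1-x)}{N}}.$$
   Context: $K(\mathbb R^n)$ is the collection of all nonempty compact subsets of $\mathbb R^n$, $|\cdot|$ is the Euclidean norm, $\mathrm{dist}(a,B)=\inf_{b\in B}|a-b|$, and $\mathrm{haus}(A,B)=\max\{\sup_{a\in A}\mathrm{dist}(a,B),\sup_{b\in B}\mathrm{dist}(b,A)\}$ is the Hausdorff distance. $\Pi_B(a)=\{b\in B:|a-b|=\mathrm{dist}(a,B)\}$. For real-valued $f$, $\omega_{[0,1]}(f,\delta)=\sup\{|f(x)-f(y)|:|x-y|\le\delta,\ x,y\in[0,1]\}$. It is a known classical result that a constant $C$ as in the claim exists (independent of $f$). A metric chain of a finite sequence of compact sets $\{A_0,\dots,A_N\}$ is a vector $(a_0,\dots,a_N)$ with $a_i\in A_i$ for all $i$, for which there is $j$, $0\le j\le N$, such that $a_{i-1}\in\Pi_{A_{i-1}}(a_i)$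 for $1\le i\le j$ and $a_{i+1}\in\Pi_{A_{i+1}}(a_i)$ for $j\le i\le N-1$. $CH(A_0,\dots,A_N)$ denotes the set of all metric chains. The metric Bernstein operator is $$B^M_N(F,x)=\Big\{\sum_{i=0}^N\binom Ni x^i(1-x)^{N-i}f_i:\ (f_0,\dots,f_N)\in CH\big(F(0),F(1/N),\dots,F(1)\big)\Big\}.$$ *)

(* Defs.v *)
From HB Require Import structures.
From mathcomp Require Import all_boot all_order all_algebra.
From mathcomp Require Import all_classical all_reals all_analysis.

Set Implicit Arguments.
Unset Strict Implicit.
Unset Printing Implicit Defensive.

Import Order.TTheory GRing.Theory Num.Theory.
Import numFieldNormedType.Exports.

Local Open Scope classical_set_scope.
Local Open Scope ring_scope.

(* The library norm `|v| on 'rV[R]_n is the sup norm, hence this definition;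
   both norms induce the topology carried by 'rV[R]_n. *)
Definition enorm (R : realType) (n : nat) (v : 'rV[R]_n) : R :=
  Num.sqrt (\sum_(i < n) v 0 i ^+ 2).

(* Infima and suprema are taken in \bar R, so that no convention is needed for
   empty or unbounded sets; on nonempty compact sets the values are finite. *)
Definition dist (R : realType) (n : nat) (a : 'rV[R]_n) (B : set 'rV[R]_n)
    : \bar R :=
  ereal_inf [set (enorm (a - b))%:E | b in B].

Definition haus (R : realType) (n : nat) (A B : set 'rV[R]_n) : \bar R :=
  maxe (ereal_sup [set dist a B | a in A]) (ereal_sup [set dist b A | b in B]).

(* proj_set B a is $\Pi_B(a)$. *)
Definition proj_set (R : realType) (n : nat) (B : set 'rV[R]_n) (a : 'rV[R]_n)
    : set 'rV[R]_n :=
  [set b | B b /\ (enorm (a - b))%:E = dist a B].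

Definition omega01 (R : realType) (f : R -> R) (delta : R) : \bar R :=
  ereal_sup [set `|f p.1 - f p.2|%:E | p in
    [set p : R * R | [/\ `|p.1 - p.2| <= delta,
                         p.1 \in `[0, 1] & p.2 \in `[0, 1]]]].

Definition bernstein_basis (R : realType) (N i : nat) (x : R) : R :=
  'C(N, i)%:R * x ^+ i * (1 - x) ^+ (N - i).

Definition bernstein (R : realType) (N : nat) (f : R -> R) (x : R) : R :=
  \sum_(i < N.+1) bernstein_basis N i x * f (i%:R / N%:R).

(* In both conditions the pair (i, k) ranges over consecutive indices. *)
Definition metric_chain (R : realType) (n N : nat)
    (A : 'I_N.+1 -> set 'rV[R]_n) : set ('I_N.+1 -> 'rV[R]_n) :=
  [set a | (forall i, A i (a i)) /\
    exists j : 'I_N.+1,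
      (forall i k : 'I_N.+1, k = i.+1 :> nat -> (k <= j)%N ->
         proj_set (A i) (a k) (a i)) /\
      (forall i k : 'I_N.+1, k = i.+1 :> nat -> (j <= i)%N ->
         proj_set (A k) (a i) (a k))].

Definition metric_bernstein (R : realType) (n N : nat)
    (F : R -> set 'rV[R]_n) (x : R) : set 'rV[R]_n :=
  [set \sum_(i < N.+1) bernstein_basis N i x *: f i
    | f in metric_chain (fun i : 'I_N.+1 => F (i%:R / N%:R))].

(* Main.v *)
Require Import Defs.
From HB Require Import structures.
From mathcomp Require Import all_boot all_order all_algebra.
From mathcomp Require Import all_classical all_reals all_analysis.
From mathcomp Require Import ring lra.

Set Implicit Arguments.
Unset Strict Implicit.
Unset Printing Implicit Defensive.

Import Order.TTheory GRing.Theory Num.Theory.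
Import numFieldNormedType.Exports.

Local Open Scope classical_set_scope.
Local Open Scope ring_scope.

(** Fix a metric chain [f_0, ..., f_N] of the samples [F (i / N)].  Of two
    consecutive members, one is a nearest point of the other in its own sample,
    so they are at distance at most [L / N]: the chain is a discrete
    [L]-Lipschitz selection ([metric_chain_step]).

    The hypothesis on [C] concerns scalar functions, while the chain takes
    values in a Euclidean space.  No factor depending on the dimension is lost
    when passing from one to the other: to bound [enorm v], where [v] is the
    difference of a Bernstein value and a point [b] of [F x], one applies a
    linear functional [phi] of norm at most 1 with [phi v = enorm v]
    ([enorm_attained]).  The scalars [phi f_i] still have steps at most
    [L / N], hence they are the grid values of an [L]-Lipschitz function on the
    line ([lipschitz_extension]).  The hypothesis applies to that function,
    whose modulus of continuity at [delta = sqrt (x (1 - x) / N)] is at most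
    [L * delta] ([omega01_lipschitz]).  So the value at [x] of its Bernstein
    polynomial is within [C * L * delta] of its own value at [x], which is
    within [L / N] of its value at a grid point [j / N] with
    [|x - j / N| <= 1 / N] ([bernstein_grid]).  If moreover [f_j] is within
    [L / N] of [b], the Bernstein value is within
    [2 * L / N + C * L * delta] of [b] ([bernstein_near]).

    Both halves of the Hausdorff distance are instances of that estimate.  For a
    given chain, [b] is a nearest point of [f_j] in [F x].  For a given [b] in
    [F x], [f_j] is a nearest point of [b] in [F (j / N)], and a chain through
    [f_j] is obtained by projecting repeatedly to the left and to the right
    ([metric_chain_through]). *)

(** * Euclidean inner product and norm *)

Definition dot (R : realType) (n : nat) (u w : 'rV[R]_n) : R :=
  \sum_(i < n) u 0 i * w 0 i.

Lemma dot_linear (R : realType) (n : nat) (u : 'rV[R]_n) :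
  linear_for *%R (dot u).
Proof.
move=> c v w; rewrite /dot mulr_sumr -big_split /=; apply: eq_bigr => i _.
by rewrite !mxE; ring.
Qed.

HB.instance Definition _ (R : realType) (n : nat) (u : 'rV[R]_n) :=
  GRing.isLinear.Build R 'rV[R]_n R *%R (dot u) (@dot_linear R n u).

Lemma enorm_ge0 (R : realType) (n : nat) (v : 'rV[R]_n) : 0 <= enorm v.
Proof. exact: sqrtr_ge0. Qed.

Lemma enorm_sqr (R : realType) (n : nat) (v : 'rV[R]_n) :
  enorm v ^+ 2 = dot v v.
Proof.
rewrite sqr_sqrtr; first by apply: eq_bigr => i _; rewrite expr2.
by apply: sumr_ge0 => i _; exact: sqr_ge0.
Qed.

(** Cauchy-Schwarz, from the nonnegativity of the quadratic form
    [(s, t) |-> |s u + t w|^2]. *)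
Lemma dot_le_enorm (R : realType) (n : nat) (u w : 'rV[R]_n) :
  `|dot u w| <= enorm u * enorm w.
Proof.
have dotC (a b : 'rV[R]_n) : dot a b = dot b a.
  by apply: eq_bigr => i _; rewrite mulrC.
have dot_ge0 (a : 'rV[R]_n) : 0 <= dot a a.
  by rewrite -enorm_sqr sqr_ge0.
rewrite -(@ler_pXn2r _ 2) ?nnegrE ?mulr_ge0 ?enorm_ge0 //.
rewrite real_normK ?num_real // exprMn !enorm_sqr.
have quad (s t : R) :
    0 <= s ^+ 2 * dot u u + 2 * s * t * dot u w + t ^+ 2 * dot w w.
  have := dot_ge0 (s *: u + t *: w).
  rewrite linearD !linearZ /= (dotC _ u) (dotC _ w) !linearD !linearZ /=.
  by rewrite (dotC w u); lra.
(* A degenerate form [s^2 * |u|^2 + 2 * s * t * (u.w)] is affine in [t], so it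
   takes negative values unless [u.w = 0]; this [t] makes it equal to [-1]. *)
have [ww0|ww_neq0] := eqVneq (dot w w) 0.
  have [->|uw_neq0] := eqVneq (dot u w) 0; first by rewrite expr0n ww0 mulr0.
  have := quad 1 (- (dot u u + 1) / (2 * dot u w)).
  suff -> : 2 * 1 * (- (dot u u + 1) / (2 * dot u w)) * dot u w =
    - (dot u u + 1) by rewrite ww0; lra.
  by field.
have ww_gt0 : 0 < dot w w by rewrite lt_def ww_neq0 dot_ge0.
(* For [s = |w|^2] this [t] minimizes the form, and the minimum is
   [|w|^2 * (|u|^2 * |w|^2 - (u.w)^2)]. *)
have := quad (dot w w) (- dot u w).
rewrite -(ler_pM2l ww_gt0); nra.
Qed.

(** The functional is the inner product with the unit vector along [v].  It
    turns an estimate on scalars into one on the Euclidean norm with the same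
    constant. *)
Lemma enorm_attained (R : realType) (n : nat) (v : 'rV[R]_n) :
  exists phi : {scalar 'rV[R]_n},
    phi v = enorm v /\ forall w, `|phi w| <= enorm w.
Proof.
exists (dot ((enorm v)^-1 *: v)).
have dotZl (c : R) (a b : 'rV[R]_n) : dot (c *: a) b = c * dot a b.
  by rewrite /dot mulr_sumr; apply: eq_bigr => i _; rewrite mxE mulrA.
rewrite /= dotZl -enorm_sqr.
have [v0|v_neq0] := eqVneq (enorm v) 0.
  rewrite v0 expr0n mulr0; split=> // w.
  by rewrite /= dotZl invr0 mul0r normr0 enorm_ge0.
split; first by rewrite expr2 mulKf.
move=> w; rewrite /= dotZl normrM ger0_norm ?invr_ge0 ?enorm_ge0 //.
rewrite mulrC ler_pdivrMr ?lt_def ?v_neq0 ?enorm_ge0 // mulrC.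
exact: dot_le_enorm.
Qed.

(** * Projections and metric chains *)

Lemma enorm_sub_continuous (R : realType) (n : nat) (a : 'rV[R]_n) :
  continuous (fun b : 'rV[R]_n => enorm (a - b)).
Proof.
have coord_cts (i : 'I_n) : continuous (fun b : 'rV[R]_n => (a - b) 0 i ^+ 2).
  have -> : (fun b : 'rV[R]_n => (a - b) 0 i ^+ 2) =
      (fun b => (a 0 i - b 0 i) * (a 0 i - b 0 i)).
    by apply/funext => b; rewrite !mxE expr2.
  move=> b.
  have coordB : {for b, continuous (fun c : 'rV[R]_n => a 0 i - c 0 i)}.
    apply: continuousB; first exact: cst_continuous.
    exact: coord_continuous.
  exact: (continuousM coordB coordB).
have sum_cts : continuous (fun b : 'rV[R]_n => \sum_(i < n) (a - b) 0 i ^+ 2).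
  by apply: continuous_big => //; exact: add_continuous.
move=> b; exact: (continuous_comp (sum_cts b) (@sqrt_continuous R _)).
Qed.

Lemma proj_set_nonempty (R : realType) (n : nat) (a : 'rV[R]_n)
    (B : set 'rV[R]_n) :
  B !=set0 -> compact B -> proj_set B a !=set0.
Proof.
move=> B0 cB.
have [b /set_mem Bb bmin] := compact_EVT_min B0 cB
  (continuous_subspaceT (@enorm_sub_continuous R n a)).
exists b; split=> //; apply/eqP; rewrite eq_le; apply/andP; split.
  apply: le_ereal_inf_tmp => _ [c Bc <-].
  by rewrite lee_fin; apply: bmin; exact: mem_set.
by apply: ereal_inf_lbound; exists b.
Qed.

Lemma haus_proj_le (R : realType) (n : nat) (A B : set 'rV[R]_n) (r : R)
    (a b : 'rV[R]_n) :
  (haus A B <= r%:E)%E -> A a -> proj_set B a b -> enorm (a - b) <= r.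
Proof.
rewrite ge_max => /andP[supA _] Aa [_ eab].
rewrite -lee_fin eab; apply: le_trans supA.
by apply: ereal_sup_ubound; exists a.
Qed.

Lemma enorm_subC (R : realType) (n : nat) (a b : 'rV[R]_n) :
  enorm (a - b) = enorm (b - a).
Proof.
by congr Num.sqrt; apply: eq_bigr => i _; rewrite !mxE -sqrrN opprB.
Qed.

Lemma hausC (R : realType) (n : nat) (A B : set 'rV[R]_n) :
  haus A B = haus B A.
Proof. by rewrite /haus maxC. Qed.

(** Start at [v] and project step by step onto the sets of larger index and onto
    those of smaller index: the point where the two orbits meet is the pivot
    of the chain. *)
Lemma metric_chain_through (R : realType) (n N : nat)
    (A : 'I_N.+1 -> set 'rV[R]_n) (j : 'I_N.+1) (v : 'rV[R]_n) :
  (forall i a, proj_set (A i) a !=set0) -> A j v ->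
  exists2 f, metric_chain A f & f j = v.
Proof.
move=> projA Ajv.
have [P PA] : {P : 'I_N.+1 -> 'rV[R]_n -> 'rV[R]_n |
    forall i a, proj_set (A i) a (P i a)}.
  by exists (fun i a => sval (cid (projA i a))) => i a; case: cid.
(* [up m] lives in the set of index [j + m], and [down m] in that of index
   [j - m]; [inord] is only meaningful as long as [j + m <= N]. *)
pose up := fix up m := if m is m'.+1 then P (inord (j + m)) (up m') else v.
pose down :=
  fix down m := if m is m'.+1 then P (inord (j - m)) (down m') else v.
pose f (i : 'I_N.+1) := if (j <= i)%N then up (i - j)%N else down (j - i)%N.
have up_proj (i k : 'I_N.+1) : k = i.+1 :> nat -> (j <= i)%N ->
    proj_set (A k) (f i) (f k).
  move=> ki ji; rewrite /f ji ki (leqW ji) subSn //=.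
  have -> : inord (j + (i - j).+1) = k.
    by apply: val_inj; rewrite /= inordK addnS subnKC // -ki.
  exact: PA.
have down_proj (i k : 'I_N.+1) : k = i.+1 :> nat -> (k <= j)%N ->
    proj_set (A i) (f k) (f i).
  move=> ki kj.
  have ij : (i < j)%N by rewrite -ki.
  (* Both branches of [f] agree at the pivot. *)
  have -> : f k = down (j - k)%N.
    rewrite /f; case: leqP => // jk.
    have -> : k = j :> nat by apply/eqP; rewrite eqn_leq kj.
    by rewrite subnn.
  rewrite /f leqNgt ij /=.
  have -> : (j - i = (j - k).+1)%N by rewrite ki subnSK.
  rewrite /=; have -> : inord (j - (j - k).+1) = i.
    by apply: val_inj; rewrite /= ki subnSK // subKn ?inordK // ltnW.
  exact: PA.
exists f; last by rewrite /f leqnn subnn.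
split; last by exists j.
move=> i; have [ji|ij|ij] := ltngtP j i.
- have iS : i.-1.+1 = i by rewrite prednK //; exact: leq_ltn_trans ji.
  have i1 : (i.-1 < N.+1)%N by rewrite iS ltnW.
  by apply: (up_proj (Ordinal i1) i _ _).1 => //=; rewrite -ltnS iS.
- have i1 : (i.+1 < N.+1)%N by exact: leq_ltn_trans (ltn_ord j).
  exact: (down_proj i (Ordinal i1) _ _).1.
- by rewrite -(val_inj ij) /f leqnn subnn.
Qed.

(** On either side of the pivot, one of the two consecutive points is a nearest
    point of the other, so their distance is a distance from a point of one
    set to the other set. *)
Lemma metric_chain_step (R : realType) (n N : nat)
    (A : 'I_N.+1 -> set 'rV[R]_n) (d : R) (f : 'I_N.+1 -> 'rV[R]_n) :
  (forall i k : 'I_N.+1, k = i.+1 :> nat -> (haus (A i) (A k) <= d%:E)%E) ->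
  metric_chain A f ->
  forall i k : 'I_N.+1, k = i.+1 :> nat -> enorm (f k - f i) <= d.
Proof.
move=> hausA [Af [j [down up]]] i k ki.
have [ji|ij] := leqP j i.
  rewrite enorm_subC.
  exact: haus_proj_le (hausA _ _ ki) (Af i) (up _ _ ki ji).
have := hausA _ _ ki; rewrite hausC => /haus_proj_le; apply=> //.
by apply: down => //; rewrite ki.
Qed.

(** * Lipschitz interpolation of scalar data *)

(** McShane's formula [f y = max_i (phi i - L * |y - p i|)]: a maximum of
    [L]-Lipschitz functions is [L]-Lipschitz, and the Lipschitz condition on the
    data says that the [i]-th one dominates at [p i]. *)
Lemma lipschitz_extension (R : realType) (m : nat) (L : R)
    (p phi : 'I_m.+1 -> R) :
  0 <= L -> (forall i k, `|phi i - phi k| <= L * `|p i - p k|) ->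
  exists2 f : R -> R, (forall y z, `|f y - f z| <= L * `|y - z|) &
    forall i, f (p i) = phi i.
Proof.
move=> L0 phiL; pose h (i : 'I_m.+1) y := phi i - L * `|y - p i|.
have hmax y : {i | forall k, h k y <= h i y}.
  exists [arg max_(i > ord0) h i y]%O.
  by case: arg_maxP => // i _ imax k; exact: imax.
(* [sval (hmax y)] is an index realizing the maximum at [y], so that
   [h (sval (hmax y)) y] is the maximum itself. *)
exists (fun y => h (sval (hmax y)) y) => [y z|i].
  suff oneside a b :
      h (sval (hmax a)) a - h (sval (hmax b)) b <= L * `|a - b|.
    by rewrite ler_norml lerNl opprB {1}distrC !oneside.
  case: (hmax a) (hmax b) => i _ [k kmax] /=.
  apply: le_trans (_ : h i a - h i b <= _); first by rewrite lerB.
  have := ler_distD a b (p i); rewrite (distrC b a) /h => tri.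
  have := ler_wpM2l L0 tri; lra.
case: (hmax (p i)) => k kmax /=; apply/eqP; rewrite eq_le; apply/andP; split.
  have := phiL k i; rewrite /h distrC (distrC (p i)) => /ler_normlP[].
  by rewrite opprB; lra.
by apply: le_trans (kmax i); rewrite /h subrr normr0 mulr0 subr0.
Qed.

Lemma lipschitz_continuous (R : realType) (L : R) (f : R -> R) :
  (forall y z, `|f y - f z| <= L * `|y - z|) -> continuous f.
Proof.
move=> fL y.
have cvgL : L * `|y - z| @[z --> y] --> 0.
  have -> : 0 = L * `|y - y| by rewrite subrr normr0 mulr0.
  apply: cvgM; first exact: cvg_cst.
  by apply: cvg_norm; apply: cvgB; [exact: cvg_cst | exact: cvg_id].
apply/cvgrPdist_le => e e0.
move/cvgrPdist_le : cvgL => /(_ e e0); apply: filterS => z /=.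
rewrite sub0r normrN => /(le_trans (ler_norm _)).
exact: le_trans.
Qed.

(** Telescoping: by the triangle inequality, step bounds add up along the
    index set. *)
Lemma dist_steps_le (R : realType) (N : nat) (phi : 'I_N.+1 -> R) (d : R) :
  (forall i k : 'I_N.+1, k = i.+1 :> nat -> `|phi k - phi i| <= d) ->
  forall i k : 'I_N.+1, `|phi i - phi k| <= d * `|i%:R - k%:R|.
Proof.
move=> step.
suff up m (i k : 'I_N.+1) : k = (i + m)%N :> nat ->
    `|phi k - phi i| <= d * m%:R.
  move=> i k; wlog ik : i k / (i <= k)%N.
    move=> H; case: (leqP i k) => [|/ltnW] /H //.
    by rewrite distrC (distrC i%:R).
  rewrite distrC (distrC i%:R) -natrB // normr_nat.
  by apply: up; rewrite subnKC.
elim: m k => [|m IH] k ki.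
  rewrite addn0 in ki.
  by rewrite (val_inj ki) subrr normr0 mulr0.
have im : (i + m < N.+1)%N.
  by rewrite -addnS -ki ltnW.
apply: le_trans (ler_distD (phi (Ordinal im)) _ _) _.
rewrite -natr1 mulrDr mulr1 addrC; apply: lerD; first exact: IH.
by apply: step; rewrite ki /= addnS.
Qed.

(** * Bernstein approximation of discrete Lipschitz data *)

Lemma omega01_lipschitz (R : realType) (L delta : R) (f : R -> R) :
  0 <= L -> (forall y z, `|f y - f z| <= L * `|y - z|) ->
  (omega01 f delta <= (L * delta)%:E)%E.
Proof.
move=> L0 fL; apply: ge_ereal_sup => _ [[y z] [yz _ _] <-].
by rewrite lee_fin; apply: le_trans (fL _ _) _; rewrite ler_wpM2l.
Qed.

(** The classical pointwise estimate for Bernstein polynomials, as a property of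
    its constant. *)
Definition bernstein_bound (R : realType) (C : R) :=
  forall f : R -> R, {within `[0, 1], continuous f} ->
  forall (N : nat) (x : R), (0 < N)%N -> x \in `[0, 1] ->
  (`|f x - bernstein N f x|%:E
     <= C%:E * omega01 f (Num.sqrt (x * (1 - x) / N%:R)))%E.

(** Bounding [C * omega01 f delta] through an upper bound on the modulus
    needs the sign of [C].  A negative [C] would make the right-hand side of
    the estimate negative for any function with a positive modulus, such as the
    identity. *)
Lemma bernstein_bound_ge0 (R : realType) (C : R) :
  bernstein_bound C -> 0 <= C.
Proof.
move=> hC; rewrite leNgt; apply/negP => C0.
(* With [N = 1] and [x = 1/2] the modulus is taken at
   [sqrt (1/4) = 1/2], and the pair [(1/2, 0)] shows that it is positive. *)
have half01 : (2^-1 : R) \in `[0, 1] by rewrite in_itv /=; lra.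
have id_cts : {within `[0, 1], continuous (@id R)}.
  by apply: continuous_subspaceT => y; exact: cvg_id.
have := hC id id_cts 1%N 2^-1 isT half01.
set delta := Num.sqrt _.
have omega_gt0 : (0 < omega01 (@id R) delta)%E.
  apply: (@lt_le_trans _ _ (2^-1)%:E).
    by rewrite lte_fin invr_gt0.
  apply: ereal_sup_ubound; exists (2^-1, 0) => /=; last first.
    by rewrite subr0 ger0_norm.
  split=> //=; last by rewrite in_itv /= lexx ler01.
  rewrite subr0 ger0_norm // /delta.
  have -> : 2^-1 * (1 - 2^-1) / 1%:R = 2^-1 ^+ 2 :> R by field.
  by rewrite sqrtr_sqr ger0_norm.
have C_omega : (C%:E * omega01 (@id R) delta < 0)%E.
  by rewrite nmule_rlt0 // lte_fin.
move=> /le_lt_trans /(_ C_omega); apply/negP.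
by rewrite -leNgt lee_fin.
Qed.

(** The hypothesis on [C] needs a function on all of [0, 1] while only the grid
    values enter the sum; a Lipschitz extension of these values provides one,
    and it is compared with [phi j] at the cost of [L * |x - j / N|]. *)
Lemma bernstein_grid (R : realType) (C L : R) (N : nat)
    (phi : 'I_N.+1 -> R) (j : 'I_N.+1) (x : R) :
  bernstein_bound C -> 0 <= L -> (0 < N)%N -> x \in `[0, 1] ->
  (forall i k : 'I_N.+1, k = i.+1 :> nat -> `|phi k - phi i| <= L / N%:R) ->
  `|\sum_(i < N.+1) bernstein_basis N i x * phi i - phi j|
    <= L * `|x - j%:R / N%:R| + C * L * Num.sqrt (x * (1 - x) / N%:R).
Proof.
move=> hC L0 N0 x01 step.
have N_gt0 : 0 < N%:R :> R by rewrite ltr0n.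
have phiL i k : `|phi i - phi k| <= L * `|i%:R / N%:R - k%:R / N%:R|.
  have := dist_steps_le step i k.
  rewrite -mulrBl normrM (@ger0_norm _ N%:R^-1) ?invr_ge0 ?ler0n //.
  by rewrite -mulrA (mulrC N%:R^-1).
have [f fL f_grid] := lipschitz_extension L0 phiL.
have -> : \sum_(i < N.+1) bernstein_basis N i x * phi i = bernstein N f x.
  by apply: eq_bigr => i _; rewrite f_grid.
rewrite -f_grid [leRHS]addrC.
apply: le_trans (ler_distD (f x) _ _) _; apply: lerD; last exact: fL.
rewrite distrC -lee_fin -mulrA EFinM.
apply: le_trans (hC f _ N x N0 x01) _.
  exact/continuous_subspaceT/(lipschitz_continuous fL).
apply: lee_wpmul2l; first by rewrite lee_fin (bernstein_bound_ge0 hC).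
exact: omega01_lipschitz.
Qed.

(** The vector form of the previous estimate: a norming functional of the
    difference reduces it to scalars.  One [L / N] comes from moving from [x] to
    [j / N], the other from moving from [f j] to [b]. *)
Lemma bernstein_near (R : realType) (n : nat) (C L : R) (N : nat)
    (f : 'I_N.+1 -> 'rV[R]_n) (b : 'rV[R]_n) (j : 'I_N.+1) (x : R) :
  bernstein_bound C -> 0 <= L -> (0 < N)%N -> x \in `[0, 1] ->
  (forall i k : 'I_N.+1, k = i.+1 :> nat -> enorm (f k - f i) <= L / N%:R) ->
  `|x - j%:R / N%:R| <= N%:R^-1 -> enorm (f j - b) <= L * `|x - j%:R / N%:R| ->
  enorm (\sum_(i < N.+1) bernstein_basis N i x *: f i - b)
    <= 2 * L / N%:R + C * L * Num.sqrt (x * (1 - x) / N%:R).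
Proof.
move=> hC L0 N0 x01 step xj fjb.
have [phi [<- phi_le]] :=
  enorm_attained (\sum_(i < N.+1) bernstein_basis N i x *: f i - b).
rewrite linearB linear_sum /=.
under eq_bigr do rewrite linearZ /=.
have phi_step (i k : 'I_N.+1) : k = i.+1 :> nat ->
    `|phi (f k) - phi (f i)| <= L / N%:R.
  by move=> ki; rewrite -linearB; apply: le_trans (phi_le _) (step _ _ ki).
have := bernstein_grid j hC L0 N0 x01 phi_step.
move=> /(le_trans (ler_norm _)) grid.
have := le_trans (phi_le _) fjb; rewrite linearB /=.
move=> /(le_trans (ler_norm _)) near.
have := ler_wpM2l L0 xj; lra.
Qed.

(** The grid point to the left of [x], of index [floor (N x)]. *)
Lemma grid_point_near (R : realType) (N : nat) (x : R) :
  (0 < N)%N -> x \in `[0, 1] ->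
  exists j : 'I_N.+1, `|x - j%:R / N%:R| <= N%:R^-1.
Proof.
move=> N0; rewrite in_itv /= => /andP[x0 x1].
have N_gt0 : 0 < N%:R :> R by rewrite ltr0n.
have xN0 : 0 <= x * N%:R by rewrite mulr_ge0 // ltW.
have /andP[lo hi] := Num.Theory.truncn_itv xN0.
have jN : (Num.truncn (x * N%:R) < N.+1)%N.
  rewrite ltnS -(ler_nat R); apply: le_trans lo _.
  by rewrite -[leRHS]mul1r ler_wpM2r // ltW.
exists (Ordinal jN) => /=.
have {1}-> : x = x * N%:R / N%:R by rewrite mulfK // gt_eqF.
rewrite -mulrBl normrM (@ger0_norm _ N%:R^-1) ?invr_ge0 ?ler0n //.
rewrite ger0_norm ?subr_ge0 // -[leRHS]mul1r ler_wpM2r ?invr_ge0 ?ler0n //.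
by rewrite lerBlDr addrC natr1 ltW.
Qed.

Theorem corollary6p2 (R : realType) (n : nat) (C : R)
  (hC : forall f : R -> R, {within `[0, 1], continuous f} ->
        forall (N : nat) (x : R), (0 < N)%N -> x \in `[0, 1] ->
        (`|f x - bernstein N f x|%:E
           <= C%:E * omega01 f (Num.sqrt (x * (1 - x) / N%:R)))%E)
  (L : R) (hL : 0 <= L)
  (F : R -> set 'rV[R]_n)
  (hF : forall x : R, x \in `[0, 1] -> F x !=set0 /\ compact (F x))
  (hLip : forall x y : R, x \in `[0, 1] -> y \in `[0, 1] ->
          (haus (F x) (F y) <= (L * `|x - y|)%:E)%E)
  (N : nat) (hN : (0 < N)%N) (x : R) (hx : x \in `[0, 1]) :
  (haus (metric_bernstein N F x) (F x)
     <= (2 * L / N%:R + C * L * Num.sqrt (x * (1 - x) / N%:R))%:E)%E.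
Proof.
have N_gt0 : 0 < N%:R :> R by rewrite ltr0n.
have grid01 (i : 'I_N.+1) : (i%:R / N%:R : R) \in `[0, 1].
  rewrite in_itv /= divr_ge0 ?ler0n //= ler_pdivrMr // mul1r ler_nat.
  by rewrite -ltnS.
have projF y a : y \in `[0, 1] -> proj_set (F y) a !=set0.
  by move=> /hF[F0 cF]; exact: proj_set_nonempty.
have grid_step (i k : 'I_N.+1) : k = i.+1 :> nat ->
    (haus (F (i%:R / N%:R)%R) (F (k%:R / N%:R)%R) <= (L / N%:R)%:E)%E.
  move=> ki; apply: le_trans (hLip _ _ (grid01 i) (grid01 k)) _.
  by rewrite ki -natr1 mulrDl mul1r opprD addNKr normrN ger0_norm //.
have [j xj] := grid_point_near hN hx.
rewrite ge_max; apply/andP; split; apply: ge_ereal_sup.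
  move=> _ [_ [f chain <-] <-].
  have [b pb] := projF x (f j) hx.
  apply: ge_ereal_inf; eexists; first by exists b; [exact: pb.1|].
  rewrite lee_fin; apply: (bernstein_near hC hL hN hx _ xj).
    exact: metric_chain_step grid_step chain.
  rewrite distrC.
  exact: haus_proj_le (hLip _ _ (grid01 j) hx) (chain.1 j) pb.
move=> _ [b Fb <-].
have [v pv] := projF _ b (grid01 j).
have [f chain fj] :=
  @metric_chain_through R n N _ j v (fun i a => projF _ a (grid01 i)) pv.1.
apply: ge_ereal_inf; eexists.
  by eexists; [exists f; [exact: chain|reflexivity]|].
rewrite lee_fin enorm_subC; apply: (bernstein_near hC hL hN hx _ xj).
  exact: metric_chain_step grid_step chain.
rewrite fj enorm_subC.
exact: haus_proj_le (hLip _ _ hx (grid01 j)) Fb pv.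
Qed.
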